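(* Let $n\ge 0$ be an integer. For every triangulation $T$ of a regular polygon with $n+3$ sides, the leading monomial of the polynomial $B_T$, for the lexicographic order with $x_1>x_2>\dots>x_{n+1}$, is the monomial $M_{D(T)}$ associated to the Dyck path $D(T)$ of length $2n+2$ corresponding to $T$ (where $B_T$, $D(T)$ and $M_D$ are defined in the context).
   Context: Labelling of the polygon: fix a vertex of the $(n+3)$-gon, called the distinguished vertex, denoted $\#$ and drawn at the bottom. In clockwise order starting from $\#$, the vertices are $\#,0,1,\dots,n,n+1$. The vertex $n+1$, which immediately follows $\#$ in the counterclockwise direction, is denoted $*$. A triangulation is a maximal set of pairwise non-crossing diagonals (sides are not diagonals). For $1\le k\le n$ the diagonal $\{\#,k\}$ is called the negative diagonal $k$. All other diagonals are called positive. Each positive diagonal crosses exactly the negative diagonals $i,\dots,j$ for some $1\le i\le j\le n$, and is then denoted $(i,j)$; it joins the vertices $i-1$ and $j+1$. Polynomials $B_T$: to each negative diagonal one associates the constant $1$, and to the positive diagonal $(i,j)$ the polynomial $\sum_{k=i}^{j}(x_k-x_{k+1})=x_i-x_{j+1}$ in the variables $x_1,\dots,x_{n+1}$. $B_T$ is the product of the polynomials associated to the diagonals of $T$ (an empty product being $1$). Dyck paths: a Dyck path of length $2n+2$ is a lattice path from $(0,0)$ to $(n+1,n+1)$ consisting of unit vertical (up) steps and unit horizontal (right) steps, staying weakly above the diagonal $y=x$. Its monomial $M_D$ is the product, over all vertical steps lying on a line of abscissa $i$ with $1\le i\le n$, of the variable $x_i$ (the initial vertical steps, at abscissa $0$,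 contribute $1$). The bijection $T\mapsto D(T)$ from triangulations of the $(n+3)$-gon with a distinguished vertex $\#$ to Dyck paths of length $2n+2$ is defined by induction on $n$. For $n=0$, the unique triangulation of the triangle is sent to the unique Dyck path of length $2$ (one vertical step, then one horizontal step). For $n\ge 1$: (a) If $*$ belongs to no diagonal of $T$, let $T'$ be the triangulation of the $(n+2)$-gon obtained from $T$ by removing the triangle adjacent to $*$, with the same distinguished vertex $\#$. Then $D(T)$ is a vertical step, followed by $D(T')$, followed by a horizontal step. (b) Otherwise, let $\{*,k_1\},\dots,\{*,k_m\}$ with $k_1<\dots<k_m$ be the diagonals of $T$ containing $*$. Cut the polygon along these diagonals into $m+1$ triangulated polygons $P_0,\dots,P_m$: $P_0$ has vertices $\#,0,\dots,k_1,*$; for $1\le r\le m$, $P_r$ has vertices $k_r,k_r+1,\dots,k_{r+1},*$, where $k_{m+1}=n$. The distinguished vertex is $\#$ for $P_0$ and $k_r$ for $P_r$ with $r\ge 1$ (so that in each piece $*$ is again the vertex immediately following the distinguished vertex counterclockwise). Then $D(T)$ is the concatenation, in this order, of the Dyck paths associated by induction to $P_0,P_1,\dots,P_m$ with their induced triangulations. Lexicographic order: the leading monomial of a polynomial is the one with the largest power of $x_1$, then, in case of a tie, the largest power of $x_2$, and so on. *)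

(* Defs.v *)
From HB Require Import structures.
From mathcomp Require Import all_boot all_order all_algebra.
From mathcomp Require Import mpoly.

Set Implicit Arguments.
Unset Strict Implicit.
Unset Printing Implicit Defensive.

Import Order.TTheory GRing.Theory.
Local Open Scope ring_scope.

(** * Triangulations *)

(* The vertices of the (n+3)-gon are numbered 0, 1, ..., n+2 in clockwise order
   starting from the distinguished vertex #.  Thus # is 0, the vertex labelled
   v (0 <= v <= n+1) is v+1, and * is n+2. *)
Notation vertex n := 'I_(n.+3).

(* A diagonal is represented by its endpoints in increasing order. *)
Definition is_diagonal n (d : vertex n * vertex n) : bool :=
  (d.1.+1 < d.2)%N && ~~ ((d.1 == ord0) && (d.2 == ord_max)).

Definition crosses n (d e : vertex n * vertex n) : bool :=
  [&& d.1 < e.1, e.1 < d.2 & d.2 < e.2]%N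
  || [&& e.1 < d.1, d.1 < e.2 & e.2 < d.2]%N.

Definition noncrossing n (T : {set vertex n * vertex n}) : bool :=
  [forall d in T, is_diagonal d]
  && [forall d in T, forall e in T, ~~ crosses d e].

Definition triangulation n (T : {set vertex n * vertex n}) : bool :=
  maxset (@noncrossing n) T.

(** * The polynomials B_T *)

(* The index of x_k, for 1 <= k <= n+1; variables are numbered from 0. *)
Definition var n (k : nat) : 'I_n.+1 := inord k.-1.

Definition is_negative n (d : vertex n * vertex n) : bool := d.1 == ord0.

Definition negative_diagonal n (k : nat) : vertex n * vertex n :=
  (ord0, inord k.+1).

(* A positive diagonal is (i, j) when it joins the vertices labelled i-1 and
   j+1, which are numbered i and j+2 here. *)
Definition diag_first n (d : vertex n * vertex n) : nat := d.1.
Definition diag_last n (d : vertex n * vertex n) : nat := d.2.-2.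

Lemma positive_crosses n (d : vertex n * vertex n) (k : nat) :
  is_diagonal d -> ~~ is_negative d -> (1 <= k <= n)%N ->
  crosses d (negative_diagonal n k) = (diag_first d <= k <= diag_last d)%N.
Proof.
case: d => [[a Ha] [b Hb]]; rewrite /is_diagonal /is_negative /crosses.
rewrite /negative_diagonal /diag_first /diag_last -!val_eqE /= => /andP[ab _] a0.
move=> /andP[k1 kn]; rewrite inordK; last by rewrite !ltnS ltnW.
rewrite -lt0n in a0; rewrite a0 /= ltnS.
by case: b ab {Hb} => [|[|b]].
Qed.

Definition diag_poly (R : comNzRingType) n (d : vertex n * vertex n) :
    {mpoly R[n.+1]} :=
  if is_negative d then 1
  else \sum_(diag_first d <= k < (diag_last d).+1)
         ('X_(var n k) - 'X_(var n k.+1)).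

Definition B (R : comNzRingType) n (T : {set vertex n * vertex n}) :
    {mpoly R[n.+1]} :=
  \prod_(d in T) diag_poly R d.

(** * Dyck paths *)

(* A lattice path from (0,0) is the sequence of its steps: [true] is a vertical
   step and [false] a horizontal one. *)
Definition is_dyck (N : nat) (w : seq bool) : bool :=
  [&& count_mem true w == N, count_mem false w == N &
      all (fun t => count_mem false (take t w) <= count_mem true (take t w))%N
          (iota 0 (size w).+1)].

(* Dyck paths of length 2N. *)
Record dyck_path (N : nat) :=
  DyckPath { steps : seq bool; stepsP : is_dyck N steps }.

(* The abscissa of the line carrying the t-th step, when that step is
   vertical. *)
Definition abscissa (w : seq bool) (t : nat) : nat := count_mem false (take t w).

Definition M n (D : dyck_path n.+1) : 'X_{1..n.+1} :=
  (\sum_(0 <= t < size (steps D) |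
         nth false (steps D) t && (1 <= abscissa (steps D) t <= n)%N)
     U_(var n (abscissa (steps D) t)))%MM.

(** * The map T |-> D(T) *)

(* The recursion runs over subpolygons of the (n+3)-gon.  A subpolygon is the
   list of its vertices in clockwise order, starting from its distinguished
   vertex; the vertex in the role of * is then the last one.  In each piece,
   the induced triangulation consists of the elements of T that are diagonals
   of that piece, so T itself is kept unchanged. *)
Definition star n (p : seq (vertex n)) : vertex n := last ord0 p.

(* All vertices of p but *. *)
Definition base n (p : seq (vertex n)) : seq (vertex n) := take (size p).-1 p.

(* The vertices of p that are neither * nor adjacent to * in p. *)
Definition inner n (p : seq (vertex n)) : seq (vertex n) := take (size p - 3) (behead p).

(* The k_1 < ... < k_m joined to * by a diagonal of p. *)
Definition hubs n (T : {set vertex n * vertex n}) (p : seq (vertex n)) :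
    seq (vertex n) := [seq k <- inner p | (k, star p) \in T].

Definition segment n (s : seq (vertex n)) (k k' : vertex n) :=
  [seq v : vertex n <- s | (k <= v <= k')%N].

(* The polygons P_0, ..., P_m: the consecutive elements k, k' of the list
   (distinguished vertex), k_1, ..., k_m, (last vertex before * ) delimit the
   polygon with vertices k, ..., k', *. *)
Definition pieces n (T : {set vertex n * vertex n}) (p : seq (vertex n)) :
    seq (seq (vertex n)) :=
  pairmap (fun k k' => rcons (segment (base p) k k') (star p))
    (head ord0 p) (rcons (hubs T p) (last ord0 (base p))).

(* [fuel] only bounds the depth of the recursion, see [path_word_fuel]. *)
Fixpoint path_word n (T : {set vertex n * vertex n}) (fuel : nat)
    (p : seq (vertex n)) : seq bool :=
  if fuel is fuel'.+1 then
    if (size p <= 3)%N then [:: true; false]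
    else if hubs T p is [::] then true :: rcons (path_word T fuel' (base p)) false
    else flatten [seq path_word T fuel' q | q <- pieces T p]
  else [::].

Lemma dyckP N w :
  reflect [/\ count_mem true w = N, count_mem false w = N &
     forall t, count_mem false (take t w) <= count_mem true (take t w)]%N
    (is_dyck N w).
Proof.
apply: (iffP and3P) => [[/eqP h1 /eqP h2 /allP h]|[h1 h2 h]]; split; rewrite ?h1 ?h2 //.
  move=> t; have [ts|ts] := leqP t (size w); first by apply: h; rewrite mem_iota ltnS.
  by rewrite take_oversize ?h1 ?h2 //; exact: ltnW.
by apply/allP => t _; apply: h.
Qed.

Lemma is_dyck_cat N1 N2 w1 w2 :
  is_dyck N1 w1 -> is_dyck N2 w2 -> is_dyck (N1 + N2)%N (w1 ++ w2).
Proof.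
move=> /dyckP[a1 b1 c1] /dyckP[a2 b2 c2]; apply/dyckP.
split; rewrite ?count_cat ?a1 ?a2 ?b1 ?b2 // => t.
by rewrite take_cat; case: ifP => // _; rewrite !count_cat a1 b1 leq_add2l.
Qed.

Lemma is_dyck_up N w : is_dyck N w -> is_dyck N.+1 (true :: rcons w false).
Proof.
move=> /dyckP[a b c]; apply/dyckP.
split; rewrite /= -?cats1 ?count_cat /= ?a ?b ?addn0 ?addn1 ?add0n ?add1n //.
case=> [|t] //=; rewrite add0n add1n take_cat; case: ifP => _.
  exact: leq_trans (c t) (leqnSn _).
rewrite !count_cat a b.
by case: (t - size w)%N => [|k] /=; rewrite ?addn0 ?addn1.
Qed.

(* A polygon, given by the list of its vertices in clockwise order. *)
Definition is_polygon n (p : seq (vertex n)) : bool :=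
  (3 <= size p)%N && sorted (fun u v : vertex n => (u < v)%N) p.

Lemma polygonE n (p : seq (vertex n)) : is_polygon p ->
  p = rcons (base p) (star p)
  /\ base p = head ord0 p :: rcons (inner p) (last ord0 (base p)).
Proof.
case/andP; case/lastP: p => // p s.
rewrite /star /base /inner last_rcons size_rcons /=.
rewrite -cats1 take_size_cat //; case: p => // x p; case/lastP: p => // p y.
rewrite cats1 /= last_rcons !size_rcons => _ _; split=> //; congr (_ :: rcons _ _).
by rewrite -!cats1 -catA subSS subSS subSS subn0 take_size_cat.
Qed.

Lemma size_base n (p : seq (vertex n)) : size (base p) = (size p).-1.
Proof. by rewrite size_take_min; apply/minn_idPl/leq_pred. Qed.

Lemma base_polygon n (p : seq (vertex n)) :
  is_polygon p -> (3 < size p)%N -> is_polygon (base p).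
Proof.
move=> /andP[_ sp] h; rewrite /is_polygon size_base take_sorted // andbT.
by case: (size p) h.
Qed.

Lemma count_split n (s : seq (vertex n)) (a b c : nat) : (a <= b <= c)%N ->
  count (fun v : vertex n => a <= v < c)%N s =
  (count (fun v : vertex n => a <= v < b) s +
   count (fun v : vertex n => b <= v < c) s)%N.
Proof.
move=> /andP[ab bc]; rewrite -count_predUI.
rewrite [X in (_ + X)%N](_ : _ = 0%N) ?addn0.
  apply: eq_count => v /=; case: (ltnP v b) => vb /=; rewrite ?andbT ?andbF ?orbF /=.
    by rewrite (leq_trans vb bc) andbT.
  by rewrite (leq_trans ab vb).
apply/eqP; rewrite -leqn0 leqNgt -has_count; apply/hasPn => v _ /=.
by case: (ltnP v b); rewrite ?andbF.
Qed.

Lemma size_segment n (s : seq (vertex n)) (k k' : vertex n) :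
  uniq s -> k \in s -> (k <= k')%N ->
  size (segment s k k') = (count (fun v : vertex n => k.+1 <= v < k'.+1)%N s).+1.
Proof.
move=> us ks kk'; rewrite size_filter.
rewrite (eq_count (a2 := fun v : vertex n => (k <= v < k'.+1)%N)); last by [].
rewrite (count_split _ (b := k.+1)) ?leqnSn ?ltnS // -[RHS]add1n; congr (_ + _)%N.
rewrite (eq_count (a2 := pred1 k)) ?count_uniq_mem ?ks // => v /=.
by rewrite ltnS -eqn_leq eq_sym.
Qed.

Lemma pairmap_segment n (p : seq (vertex n)) (k : vertex n) ks :
  is_polygon p -> k \in base p -> {subset ks <= base p} ->
  path (fun u v : vertex n => (u < v)%N) k ks ->
  let qs := pairmap (fun k k' => rcons (segment (base p) k k') (star p)) k ks in
  {in qs, forall q, is_polygon q} /\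
  (\sum_(q <- qs) (size q - 2) =
    count (fun v : vertex n => k.+1 <= v < (last k ks).+1) (base p))%N.
Proof.
move=> pp; have [pE _] := polygonE pp; case/andP: (pp) => _ sp.
have tr : transitive (fun u v : vertex n => (u < v)%N).
  by move=> ? ? ?; apply: ltn_trans.
have us : uniq (base p).
  apply: (sorted_uniq tr); first by move=> ?; apply: ltnn.
  exact: take_sorted.
elim: ks k => [|k' ks IH] k kp sub /=.
  move=> _; split=> //; rewrite big_nil; apply/esym/eqP.
  rewrite -leqn0 leqNgt -has_count; apply/hasPn => v _ /=.
  by rewrite ltnS; case: ltnP => // h; rewrite leqNgt h.
case/andP=> kk' pk; have k'p : k' \in base p by apply: sub; rewrite inE eqxx.
have sub' : {subset ks <= base p} by move=> v vk; apply: sub; rewrite inE vk orbT.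
have [IH1 IH2] := IH k' k'p sub' pk.
have sz := size_segment us kp (ltnW kk').
have pos : (0 < count (fun v : vertex n => k.+1 <= v < k'.+1) (base p))%N.
  by rewrite -has_count; apply/hasP; exists k'; rewrite //= kk' ltnSn.
split.
  move=> q; rewrite inE => /predU1P[->|/IH1//].
  rewrite /is_polygon size_rcons sz !ltnS pos /=.
  apply: (subseq_sorted tr _ sp); rewrite [X in subseq _ X]pE -!cats1.
  by rewrite cat_subseq ?filter_subseq.
rewrite big_cons IH2 size_rcons sz !subSS subn0 -count_split // ltnS ltnW //=.
rewrite ltnS; have := order_path_min tr pk.
case/lastP: (ks) => [|t y] //= /allP/(_ y); rewrite last_rcons mem_rcons inE eqxx.
by move=> h; rewrite ltnW // h.
Qed.

Lemma breaks_polygon n (T : {set vertex n * vertex n}) (p : seq (vertex n)) :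
  is_polygon p ->
  [/\ head ord0 p \in base p,
      {subset rcons (hubs T p) (last ord0 (base p)) <= base p} &
      path (fun u v : vertex n => (u < v)%N) (head ord0 p)
        (rcons (hubs T p) (last ord0 (base p)))].
Proof.
move=> pp; have [pE bE] := polygonE pp; case/andP: (pp) => _ sp.
have tr : transitive (fun u v : vertex n => (u < v)%N).
  by move=> ? ? ?; apply: ltn_trans.
have sub : subseq (head ord0 p :: rcons (hubs T p) (last ord0 (base p))) (base p).
  rewrite [X in subseq _ X]bE /= eqxx -!cats1.
  by rewrite cat_subseq ?filter_subseq.
split; first by rewrite bE mem_head.
  by move=> v vh; apply: (mem_subseq sub); rewrite inE vh orbT.
apply: (subseq_sorted tr sub); exact: take_sorted.
Qed.

Lemma pieces_polygon n (T : {set vertex n * vertex n}) (p : seq (vertex n)) :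
  is_polygon p ->
  {in pieces T p, forall q, is_polygon q} /\
  (\sum_(q <- pieces T p) (size q - 2) = size p - 2)%N.
Proof.
move=> pp; have [h1 h2 h3] := breaks_polygon T pp.
have [q1 q2] := pairmap_segment pp h1 h2 h3; split=> //.
rewrite [LHS]q2 last_rcons; have [pE bE] := polygonE pp.
case/andP: (pp) => _ sp.
have tr : transitive (fun u v : vertex n => (u < v)%N).
  by move=> ? ? ?; apply: ltn_trans.
have sb : sorted (fun u v : vertex n => (u < v)%N) (base p) by exact: take_sorted.
have -> : (size p - 2 = size (behead (base p)))%N.
  by rewrite size_behead size_base subn2.
rewrite bE /= ltnn /= add0n; apply/eqP; rewrite -all_count.
move: sb; rewrite bE /=; set z := last _ _; set r := inner p => sb.
have := order_path_min tr sb => /allP lo.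
have hi : sorted (fun u v : vertex n => (u < v)%N) (rcons r z) by exact: path_sorted sb.
apply/allP => v; rewrite /= !last_rcons => vr; rewrite (lo v vr) /= ltnS.
move: vr; rewrite mem_rcons inE => /predU1P[->//|vr].
rewrite -rev_sorted rev_rcons /= in hi.
have := order_path_min _ hi => /(_ _)/allP/(_ v); rewrite mem_rev vr.
by move=> h; apply/ltnW/h => // ? ? ? /[swap]; apply: ltn_trans.
Qed.

Lemma pieces_small n (T : {set vertex n * vertex n}) (p : seq (vertex n)) :
  is_polygon p -> hubs T p != [::] ->
  {in pieces T p, forall q, (size q < size p)%N}.
Proof.
move=> pp hp q qp; have [pol tot] := pieces_polygon T pp.
have /andP[q3 _] := pol q qp; have /andP[p3 _] := pp.
have szq : (1 < size (pieces T p))%N.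
  by rewrite size_pairmap size_rcons ltnS lt0n size_eq0.
move: tot; rewrite (big_rem q) //= => tot.
have: (0 < \sum_(q <- rem q (pieces T p)) (size q - 2))%N.
  have := size_rem qp; case E: (rem q _) => [|q' r].
    by move=> /= h; move: szq; case: (pieces T p) h => [|? []].
  have /pol/andP[h _] : q' \in pieces T p by apply: (mem_rem (x := q)); rewrite E mem_head.
  by move=> _; rewrite big_cons addn_gt0 subn_gt0 h.
move: tot; move: (\sum_(_ <- _) _)%N => S tot S0.
have: (size q - 2 < size p - 2)%N by rewrite -tot -[ltnLHS]addn0 ltn_add2l.
by rewrite ltn_sub2rE // ltnW.
Qed.

Lemma flatten_dyck n (g : seq (vertex n) -> seq bool) (qs : seq (seq (vertex n))) :
  {in qs, forall q, is_dyck (size q - 2) (g q)} ->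
  is_dyck (\sum_(q <- qs) (size q - 2)) (flatten [seq g q | q <- qs]).
Proof.
elim: qs => [|q qs IH] h; first by rewrite big_nil.
rewrite big_cons /=; apply: is_dyck_cat; first by apply: h; rewrite mem_head.
by apply: IH => r rq; apply: h; rewrite inE rq orbT.
Qed.

Lemma path_word_dyck n (T : {set vertex n * vertex n}) fuel (p : seq (vertex n)) :
  is_polygon p -> (size p <= fuel)%N ->
  is_dyck (size p - 2) (path_word T fuel p).
Proof.
elim: fuel p => [|fuel IH] p pp; first by case/andP: pp; case: (size p).
have /andP[p3 _] := pp; move=> pf /=; case: leqP => [p3'|p4].
  by have /eqP-> : size p == 3 by rewrite eqn_leq p3' p3.
case E: (hubs T p) => [|k ks].
  have -> : (size p - 2 = (size (base p) - 2).+1)%N.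
    by rewrite size_base; case: (size p) p4 => [|[|[|[|]]]].
  apply/is_dyck_up/IH; first exact: base_polygon.
  by rewrite size_base; case: (size p) pf.
have [pol <-] := pieces_polygon T pp; apply: flatten_dyck => q qp.
apply: IH; first exact: pol.
by rewrite -ltnS (leq_trans _ pf) // (pieces_small (T := T)) // E.
Qed.

Lemma path_word_fuel n (T : {set vertex n * vertex n}) fuel1 fuel2 (p : seq (vertex n)) :
  is_polygon p -> (size p <= fuel1)%N -> (size p <= fuel2)%N ->
  path_word T fuel1 p = path_word T fuel2 p.
Proof.
elim: fuel1 fuel2 p => [|f1 IH] [|f2] p pp; have /andP[p3 _] := pp.
- by [].
- by case: (size p) p3.
- by case: (size p) p3.
move=> pf1 pf2 /=; case: leqP => // p4.
case E: (hubs T p) => [|k ks].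
  congr (_ :: rcons _ _); apply: IH; first exact: base_polygon.
    by rewrite size_base; case: (size p) pf1.
  by rewrite size_base; case: (size p) pf2.
congr flatten; apply/eq_in_map => q qp.
have [pol _] := pieces_polygon T pp.
have sq : (size q < size p)%N by rewrite (pieces_small (T := T)) // E.
by apply: IH; rewrite ?pol // -ltnS (leq_trans sq).
Qed.

Definition whole_polygon n : seq (vertex n) := enum (vertex n).

Lemma whole_polygonP n : is_polygon (whole_polygon n).
Proof.
rewrite /is_polygon size_enum_ord /=.
by have := iota_ltn_sorted 0 n.+3; rewrite -val_enum_ord sorted_map.
Qed.

Lemma D_subproof n (T : {set vertex n * vertex n}) :
  is_dyck n.+1 (path_word T n.+3 (whole_polygon n)).
Proof.
have -> : n.+1 = (size (whole_polygon n) - 2)%N by rewrite size_enum_ord !subSS subn0.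
by apply: path_word_dyck; rewrite ?whole_polygonP // size_enum_ord.
Qed.

Definition D n (T : {set vertex n * vertex n}) : dyck_path n.+1 :=
  DyckPath (D_subproof T).

(** * Lexicographic order *)

(* The order with x_1 > x_2 > ... and no comparison of total degrees, unlike
   the order on monomials used by [mlead]. *)
Definition lex_lt k (m1 m2 : 'X_{1..k}) : bool :=
  [exists i : 'I_k, (m1 i < m2 i)%N &&
     [forall j : 'I_k, (j < i)%N ==> (m1 j == m2 j)]].

Definition is_leading_monomial (R : comNzRingType) k
    (p : {mpoly R[k]}) (m : 'X_{1..k}) : Prop :=
  m \in msupp p /\ forall m', m' \in msupp p -> m' != m -> lex_lt m' m.

(* Main.v *)
Require Import Defs.
From mathcomp Require Import all_boot all_order all_algebra.
From mathcomp Require Import mpoly zify.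

Set Implicit Arguments.
Unset Strict Implicit.
Unset Printing Implicit Defensive.

Import Order.TTheory GRing.Theory.
Local Open Scope ring_scope.

(* The factor of B_T attached to a positive diagonal with smaller endpoint
   (numbered) i has leading term x_i with coefficient 1, so, leading monomials
   being multiplicative, the exponent of x_i in the leading monomial of B_T is
   the number of diagonals of T whose smaller endpoint is i.  For the path side
   one proves, by induction over the subpolygons produced by the recursion, that
   the number of vertical steps at the abscissa given by the rank of a vertex u
   is the number of chords of the subpolygon with smaller endpoint u, the root
   edge between the distinguished vertex and * counting as a chord.  Maximality
   of T is only used when * has no diagonal: then the two neighbours of *, namely
   the distinguished vertex and the last vertex before *, are joined by a
   diagonal of T, which is the root edge of the next subpolygon. *)

(** * Lexicographic leading monomials *)

Section LexMonic.
Variables (R : comNzRingType) (k : nat).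
Implicit Types (m a b : 'X_{1..k}) (p q : {mpoly R[k]}).

Definition lex_le a b : bool := (a == b) || lex_lt a b.

Lemma lex_ltP a b :
  reflect (exists2 i : 'I_k, (a i < b i)%N &
             forall j : 'I_k, (j < i)%N -> a j = b j)
          (lex_lt a b).
Proof.
apply: (iffP existsP) => [[i /andP[ab /forallP h]]|[i ab h]]; exists i => //.
  by move=> j ji; apply/eqP/(implyP (h j)).
by rewrite ab; apply/forallP => j; apply/implyP => ji; rewrite h.
Qed.

Lemma lex_ltxx a : lex_lt a a = false.
Proof. by apply/lex_ltP => -[i]; rewrite ltnn. Qed.

(** The sums first differ at the smaller of the two positions of first difference; when these
    coincide, both strict inequalities add up. *)
Lemma lex_lt_le_add a b m1 m2 :
  lex_lt a m1 -> lex_le b m2 -> lex_lt (a + b)%MM (m1 + m2)%MM.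
Proof.
move=> /lex_ltP[i ai ali] /predU1P[->|/lex_ltP[j bj blj]]; apply/lex_ltP.
  by exists i => [|l li]; rewrite !mnmDE ?ltn_add2r // ali.
have [ij|ji|/val_inj ij] := ltngtP i j.
- exists i => [|l li]; rewrite !mnmDE; first by rewrite blj // ltn_add2r.
  by rewrite ali ?blj //; apply: ltn_trans ij.
- exists j => [|l li]; rewrite !mnmDE; first by rewrite ali // ltn_add2l.
  by rewrite blj ?ali //; apply: ltn_trans ji.
- subst j; exists i => [|l li]; rewrite !mnmDE; last by rewrite ali ?blj.
  by rewrite -addSn leq_add // ltnW.
Qed.

Lemma lex_le_lt_add a b m1 m2 :
  lex_le a m1 -> lex_lt b m2 -> lex_lt (a + b)%MM (m1 + m2)%MM.
Proof. by move=> ha hb; rewrite addmC [X in lex_lt _ X]addmC lex_lt_le_add. Qed.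

(* Leading monomial [m] with coefficient 1, in a form stable under products even
   when [R] has zero divisors. *)
Definition lex_monic p m : Prop := {in msupp (p - 'X_[m]), forall a, lex_lt a m}.

Lemma lex_monic_le p m : lex_monic p m -> {in msupp p, forall a, lex_le a m}.
Proof.
move=> pm a; rewrite -[p](subrK 'X_[m]) => /msuppD_le; rewrite mem_cat.
case/orP=> [/pm h|]; first by rewrite /lex_le h orbT.
by rewrite msuppX inE => /eqP->; rewrite /lex_le eqxx.
Qed.

(** By irreflexivity [m] is absent from the support of [p - 'X_[m]], so its coefficient in [p] is 1,
    which is nonzero in [R]. *)
Lemma lex_monic_leading p m : lex_monic p m -> is_leading_monomial p m.
Proof.
move=> pm; split=> [|a ap am]; last first.
  by have := lex_monic_le pm ap; rewrite /lex_le (negPf am).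
have : (p - 'X_[m])@_m = 0.
  by apply/memN_msupp_eq0/negP => /pm; rewrite lex_ltxx.
rewrite mcoeffB mcoeffX eqxx => /eqP; rewrite subr_eq0 => /eqP e.
by rewrite mcoeff_msupp e oner_eq0.
Qed.

Lemma lex_monic1 : lex_monic 1 0%MM.
Proof. by move=> a; rewrite mpolyX0 subrr msupp0. Qed.

Lemma lex_monicM p q m1 m2 :
  lex_monic p m1 -> lex_monic q m2 -> lex_monic (p * q) (m1 + m2)%MM.
Proof.
move=> pm qm a.
(* Each summand is one error term, whose monomials are strictly smaller, times a factor bounded by
   its own leading monomial. *)
have -> : p * q - 'X_[m1 + m2] = (p - 'X_[m1]) * q + 'X_[m1] * (q - 'X_[m2]).
  by rewrite mpolyXD mulrBl mulrBr addrA subrK.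
move=> /msuppD_le; rewrite mem_cat => /orP[] /msuppM_le /allpairsP[[b c] /= [hb hc ->]].
  by apply: lex_lt_le_add; [apply: pm | apply: lex_monic_le qm _ hc].
apply: lex_le_lt_add; last exact: qm.
by move: hb; rewrite msuppX inE => /eqP->; rewrite /lex_le eqxx.
Qed.

Lemma lex_monic_prod (I : finType) (P : pred I) (F : I -> {mpoly R[k]})
    (f : I -> 'X_{1..k}) :
  (forall i, P i -> lex_monic (F i) (f i)) ->
  lex_monic (\prod_(i | P i) F i) (\sum_(i | P i) f i)%MM.
Proof.
move=> h; elim/big_rec2: _ => [|i m p Pi]; first exact: lex_monic1.
exact/lex_monicM/h.
Qed.

Lemma lex_monic_XB (i j : 'I_k) : (i < j)%N -> lex_monic ('X_i - 'X_j) U_(i)%MM.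
Proof.
move=> ij a; rewrite addrAC subrr add0r (perm_mem (msuppN _)) msuppX inE => /eqP->.
apply/lex_ltP; exists i => [|l li]; rewrite !mnm1E -!val_eqE /=; lia.
Qed.

End LexMonic.

(** * Leading monomials of the diagonal polynomials and of their product *)

Section DiagonalPolynomials.
Variables (R : comNzRingType) (n : nat).
Implicit Types (d : vertex n * vertex n) (T : {set vertex n * vertex n}).

Lemma triangulation_diagonal T d : triangulation T -> d \in T -> is_diagonal d.
Proof. by move=> /maxsetp/andP[/forall_inP h _] /h. Qed.

Lemma diag_poly_monic d : is_diagonal d -> ~~ is_negative d ->
  lex_monic (diag_poly R d) U_(var n d.1)%MM.
Proof.
case: d => [[a an] [b bn]] /andP[/= ab _]; rewrite /is_negative -val_eqE /= => a0.
rewrite /diag_poly /is_negative /diag_first /diag_last -val_eqE /= (negPf a0).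
case: b ab bn => [|[|b]]//; rewrite !ltnS => ab bn /=.
(* The negated variables serve as primitive, so that only the first variable and, with a minus sign,
   the last one remain. *)
rewrite (@telescope_sumr_eq _ _ _ (fun i => - 'X_(var n i))).
- rewrite opprK addrC; apply: lex_monic_XB.
  by rewrite !inordK; lia.
- by lia.
- by move=> i _; rewrite opprK addrC.
Qed.

Lemma B_leading T : triangulation T ->
  is_leading_monomial (B R T)
    (\sum_(d | (d \in T) && ~~ is_negative d) U_(var n d.1))%MM.
Proof.
move=> hT; apply: lex_monic_leading.
have -> : B R T = \prod_(d | (d \in T) && ~~ is_negative d) diag_poly R d.
  rewrite /B big_mkcondr; apply: eq_bigr => d _.
  by rewrite /diag_poly; case: (is_negative d).
apply: lex_monic_prod => d /andP[/(triangulation_diagonal hT)]; exact: diag_poly_monic.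
Qed.

End DiagonalPolynomials.

(** * Vertical steps of words *)

Section Words.
Local Open Scope nat_scope.
Implicit Types (w : seq bool) (a : nat).

Definition ups w a : nat :=
  \sum_(0 <= t < size w) (nth false w t && (abscissa w t == a)).

Lemma ups_nil a : ups [::] a = 0.
Proof. by rewrite /ups big_geq. Qed.

Lemma ups_cons b w a :
  ups (b :: w) a =
  (b && (a == 0)) + (if b then ups w a else if a is a'.+1 then ups w a' else 0).
Proof.
rewrite /ups [size _]/= big_nat_recl //=; congr (_ + _); first by rewrite eq_sym.
case: b; case: a => [|a] //=.
by rewrite big1 // => i _; rewrite andbF.
Qed.

(** The horizontal steps of [w1] shift every abscissa of [w2]; the test guards the truncated
    subtraction. *)
Lemma ups_cat w1 w2 a :
  ups (w1 ++ w2) a =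
  ups w1 a + (if count_mem false w1 <= a then ups w2 (a - count_mem false w1) else 0).
Proof.
elim: w1 a => [|b w1 IH] a; first by rewrite /= subn0 ups_nil.
rewrite cat_cons !ups_cons -addnA; congr (_ + _).
case: b => /=; first by rewrite IH.
by case: a => [|a] //; rewrite IH.
Qed.

Lemma ups_large w a : count_mem false w < a -> ups w a = 0.
Proof.
elim: w a => [|b w IH] a; first by rewrite ups_nil.
by rewrite ups_cons; case: b; case: a => [|a] //= h; rewrite IH.
Qed.

(** The new first step stands at abscissa 0 and shifts nothing; no vertical step follows the new
    last one. *)
Lemma ups_up w a : ups (true :: rcons w false) a = (a == 0) + ups w a.
Proof.
rewrite ups_cons -cats1 ups_cat; congr (_ + _).
by rewrite ups_cons; case: (_ - _) => [|b]; rewrite /= ?ups_nil; case: ifP; rewrite !addn0.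
Qed.

(** The index [i] stands for the variable numbered [i.+1]. The last index [n] gets exponent 0, since
    abscissas above [n] are not counted. *)
Lemma M_ups n (d : dyck_path n.+1) (i : 'I_n.+1) :
  M d i = if i < n then ups (steps d) i.+1 else 0.
Proof.
rewrite /M mnm_sumE big_mkcond /=.
have E (t : nat) : 
  (if nth false (steps d) t && (0 < abscissa (steps d) t <= n)
   then U_(var n (abscissa (steps d) t))%MM i else 0) =
  nth false (steps d) t && (abscissa (steps d) t == i.+1) && (i < n).
  case: (nth _ _ t) => //=; case: ifP => [/andP[a0 an]|h].
    rewrite mnm1E /var -[inord _ == i]val_eqE /= inordK; lia.
  have := ltn_ord i; lia.
rewrite (eq_bigr _ (fun t _ => E t)) /ups.
case: ifP => _; first by apply: eq_bigr => t _; rewrite andbT.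
by rewrite big1 // => t _; rewrite andbF.
Qed.

End Words.

(** * Chords of subpolygons *)

(* Membership hypotheses blow up the case analysis made by [lia]. *)
Ltac order_lia :=
  repeat match goal with H : context [in_mem _ _] |- _ => clear H end; lia.

Section Polygons.
Local Open Scope nat_scope.
Variables (n : nat) (T : {set vertex n * vertex n}).
Hypothesis hT : triangulation T.
Implicit Types (p : seq (vertex n)) (u v k : vertex n).

Definition uncrossed u v : bool := [forall e in T, ~~ crosses e (u, v)].

Lemma uncrossedP u v :
  reflect (forall x y : vertex n, (x, y) \in T -> ~~ crosses (x, y) (u, v))
          (uncrossed u v).
Proof.
apply: (iffP forall_inP) => [h x y xyT|h [x y] xyT]; exact: h.
Qed.

Lemma uncrossed_mem u v : (u, v) \in T -> uncrossed u v.
Proof.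
move=> uvT; apply/uncrossedP => x y xyT.
by case/maxsetp/andP: hT => _ /forall_inP/(_ _ xyT)/forall_inP/(_ _ uvT).
Qed.

(** Adjoining the pair to [T] keeps it noncrossing, as crossing is symmetric and irreflexive;
    maximality then puts the pair in [T]. *)
Lemma mem_uncrossed u v : is_diagonal (u, v) -> uncrossed u v -> (u, v) \in T.
Proof.
move=> duv /forall_inP cuv; have /maxsetP[/andP[/forall_inP dT /forall_inP cT] mT] := hT.
rewrite -(mT ((u, v) |: T)) ?setU11 ?subsetUr //; apply/andP; split.
  by apply/forall_inP => d /setU1P[->|/dT].
apply/forall_inP => d hd; apply/forall_inP => e he.
case/setU1P: hd => [->|hd]; case/setU1P: he => [->|he].
- by rewrite /crosses /=; order_lia.
- by have := cuv e he; rewrite /crosses /=; order_lia.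
- exact: cuv.
- by have /forall_inP := cT d hd; apply.
Qed.

(** For vertices [u < v] of a polygon [p], this fails exactly when they are consecutive in [p], that
    is, joined by a side other than the root edge. *)
Definition between p u v : bool := has (fun w : vertex n => u < w < v) p.

Lemma betweenP p u v :
  reflect (exists2 w, w \in p & u < w < v) (between p u v).
Proof. exact: hasP. Qed.

(* The invariant of the recursion: the sides of [p], which need not belong to
   [T] since they may be sides of the whole polygon, are crossed by no element
   of [T]. *)
Definition clean p : Prop :=
  [/\ is_polygon p,
      {in p &, forall u v, u < v -> ~~ between p u v -> uncrossed u v} &
      uncrossed (head ord0 p) (star p)].

(* Requiring a vertex of [p] between [u] and [v] excludes the sides of [p], which
   may belong to [T]; the second disjunct is the root edge. *)
Definition degree p u : nat :=
  count (fun v => between p u v &&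
           (((u, v) \in T) || ((u == head ord0 p) && (v == star p)))) p.

Lemma polygon_mem p : is_polygon p ->
  [/\ forall v, (v \in p) = (v \in base p) || (v == star p),
      forall v, v \in base p -> head ord0 p <= v <= last ord0 (base p),
      last ord0 (base p) < star p,
      forall v, (v \in inner p) =
        (v \in base p) && (head ord0 p < v < last ord0 (base p)) &
      (head ord0 p \in base p) && (last ord0 (base p) \in base p)].
Proof.
move=> pp; have [pE bE] := polygonE pp; case/andP: (pp) => _.
have tr : transitive (fun u v : vertex n => (u < v)%N).
  by move=> ? ? ?; apply: ltn_trans.
rewrite {1}pE; set s := star p; set b := base p.
(* Reversal brings the last element to the head, where the bound on all later elements of a path
   applies. *)
rewrite -[rcons _ _]revK rev_rcons rev_sorted /= => hs.
have := order_path_min (rev_trans tr) hs; rewrite all_rev => /allP bs.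
have : sorted (fun u v : vertex n => (u < v)%N) b by rewrite -[b]revK rev_sorted; apply: path_sorted hs.
rewrite /b {1}bE; set h := head _ _; set z := last _ _; rewrite /= => hb.
have /allP hm := order_path_min tr hb.
have := path_sorted hb.
rewrite -[rcons _ _]revK rev_rcons rev_sorted /= => hz.
have := order_path_min (rev_trans tr) hz; rewrite all_rev => /allP zm.
have zb : z \in b by rewrite /b bE inE mem_rcons inE eqxx orbT.
have hb' : h \in b by rewrite /b bE inE eqxx.
have hz' : h < z by apply: hm; rewrite mem_rcons inE eqxx.
have hv v : (v \in b) = (v == h) || (v == z) || (v \in inner p).
  by rewrite /b bE inE mem_rcons inE orbA.
split.
- by move=> v; rewrite {1}pE mem_rcons inE orbC.
- move=> v; rewrite hv => /orP[/orP[]/eqP-> | vi]; try by rewrite leqnn ltnW.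
  by apply/andP; split; apply: ltnW; [apply: hm | apply: zm];
    rewrite // mem_rcons inE vi orbT.
- exact: bs.
- move=> v; apply/idP/idP => [vi|].
    by rewrite hv vi orbT /= hm ?zm // mem_rcons inE vi orbT.
  by rewrite hv -!val_eqE => /andP[/orP[/orP[]/eqP->|//]]; rewrite ltnn ?andbF.
by rewrite zb hb'.
Qed.

(** This finds the side of a subpolygon that cuts off a vertex [x] missing from it: the last entry
    below [x] and the first one above. *)
Lemma sorted_gap (h : vertex n) (l : seq (vertex n)) (x : nat) :
  path (fun u v : vertex n => u < v) h l -> h < x < last h l ->
  (forall w, w \in l -> w != x :> nat) ->
  exists u v, [/\ u \in h :: l, v \in h :: l, u < x < v & ~~ between (h :: l) u v].
Proof.
elim: l h => [|y l IH] h; first by rewrite /=; order_lia.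
move=> /andP[hy yl] /andP[hx xl] nx.
have tr : transitive (fun u v : vertex n => (u < v)%N).
  by move=> ? ? ?; apply: ltn_trans.
have /allP ym := order_path_min tr yl.
have := nx y (mem_head _ _).
case: (ltngtP y x) => // yx _.
  have [||u [v [ul vl uxv uv]]] := IH y yl; first by rewrite yx.
    by move=> w wl; apply: nx; rewrite inE wl orbT.
  exists u, v; split=> //; try by rewrite in_cons ?ul ?vl orbT.
  rewrite /between /= in uv *; rewrite negb_or uv andbT.
  by case/predU1P: ul => [->|/ym]; order_lia.
exists h, y; split; first exact: mem_head.
- by rewrite !in_cons eqxx orbT.
- by rewrite hx.
by apply/betweenP => -[w]; rewrite !in_cons => /predU1P[->|/predU1P[->|/ym]]; order_lia.
Qed.

(** An element of [T] crossing this pair would have to end at [star p], since the root edge and the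
    side before [star p] are uncrossed. Its other end would be a hub if it lay in [p], and would be
    cut off by a crossed side otherwise. So nothing crosses the pair, and maximality applies. *)
Lemma base_diagonal p : clean p -> 3 < size p -> hubs T p = [::] ->
  (head ord0 p, last ord0 (base p)) \in T.
Proof.
move=> [pp cp rp] sp hp; have [pm hz zs im /andP[hb zb]] := polygon_mem pp.
have [pE bE] := polygonE pp.
set h := head ord0 p in rp hz im hb bE *; set z := last _ _ in hz zs im zb bE *.
set s := star p in rp zs pm pE *.
have hubE v : (v \in hubs T p) = ((v, s) \in T) && (v \in inner p).
  by rewrite mem_filter.
clearbody h z s.
apply: mem_uncrossed.
  (* An inner vertex separates the two endpoints, and [z < s] keeps the pair from being the side
     joining the first and last vertices of the whole polygon. *)
  have : 0 < size (inner p) by rewrite size_take size_behead; case: ifP; order_lia.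
  case E: (inner p) => [//|v l] _; have : v \in inner p by rewrite E mem_head.
  rewrite im => /andP[_ hvz]; rewrite /is_diagonal /= -!val_eqE /=.
  by have := ltn_ord s; order_lia.
apply/uncrossedP => x y xyT; apply/negP => xy.
have := uncrossedP _ _ rp x y xyT; have := zs; rewrite /crosses /= in xy * => {}zs rxy.
(* The other way of crossing [(h, z)] would also cross the root edge [(h, s)]. *)
have [hx zy] : h < x < z /\ z < y by order_lia.
have ys : y <= s by order_lia.
(* An endpoint strictly between [z] and [s] would make [(x, y)] cross the side [(z, s)]. *)
have {}ys : y = s.
  apply/val_inj/eqP; rewrite eqn_leq ys /= leqNgt; apply/negP => ys'.
  have := cp z s; rewrite !pm zb eqxx orbT => /(_ isT isT zs).
  case: (boolP (between p z s)) => [/betweenP[w]|_ /(_ isT)].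
    by rewrite pm => /orP[/hz|/eqP->]; order_lia.
  by move=> /uncrossedP/(_ _ _ xyT); rewrite /crosses /=; order_lia.
subst y; clear xy rxy.
case: (boolP (x \in base p)) => [xb|xb].
  have : x \in hubs T p by rewrite hubE xyT im xb.
  by rewrite hp.
(* Here [x] is not a vertex of [p], so it lies between two consecutive vertices [u] and [v], and
   [(x, s)] crosses that side. *)
have sb : sorted (fun u v : vertex n => u < v) (base p).
  by case/andP: pp => _; apply: take_sorted.
have [|||u [v]] := @sorted_gap h (rcons (inner p) z) x.
- by move: sb; rewrite bE.
- by rewrite last_rcons.
- move=> w wi; apply: contraNneq xb => /val_inj <-.
  by rewrite bE inE wi orbT.
rewrite -bE => -[ub vb uxv uv].
have nb : ~~ between p u v.
  apply: contra uv => /betweenP[w]; rewrite pm => /orP[wb uwv|/eqP->].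
    by apply/betweenP; exists w.
  by have := hz v vb; order_lia.
have /uncrossedP/(_ _ _ xyT) : uncrossed u v.
  by apply: cp nb; rewrite ?pm ?ub ?vb //; order_lia.
by have := hz v vb; rewrite /crosses /=; order_lia.
Qed.

(** The root edge ends at [star p], so its disjunct disappears from the count over [base p]. *)
Lemma degree_split p u : is_polygon p ->
  degree p u = count (fun v => between p u v && ((u, v) \in T)) (base p) +
    (between p u (star p) && (((u, star p) \in T) || (u == head ord0 p))).
Proof.
move=> pp; have [pm hz zs im _] := polygon_mem pp; have [pE _] := polygonE pp.
rewrite /degree [X in count _ X]pE -cats1 count_cat /= addn0 eqxx andbT; congr (_ + _).
apply: eq_in_count => v vb; rewrite [v == _](_ : _ = false) ?andbF ?orbF //.
by apply/negbTE; rewrite -val_eqE /=; have := hz v vb; order_lia.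
Qed.

Lemma degree_star p : is_polygon p -> degree p (star p) = 0.
Proof.
move=> pp; have [pm hz zs im _] := polygon_mem pp.
apply/eqP; rewrite -leqn0 leqNgt -has_count; apply/hasPn => v; rewrite pm => vp.
rewrite negb_and; apply/orP; left; apply/betweenP => -[w _].
by case/orP: vp => [/hz|/eqP->]; order_lia.
Qed.

Lemma head_base p : is_polygon p -> head ord0 (base p) = head ord0 p.
Proof. by move=> /polygonE[_ ->]. Qed.

Lemma between_base p u v : is_polygon p -> v \in base p ->
  between (base p) u v = between p u v.
Proof.
move=> pp vb; have [pm hz zs im _] := polygon_mem pp.
apply/betweenP/betweenP => -[w wb uwv]; exists w => //; first by rewrite pm wb.
by move: wb; rewrite pm => /orP[//|/eqP ws]; subst w; have := hz v vb; order_lia.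
Qed.

(** The only new side is the root edge of [base p], which belongs to [T] and hence is uncrossed. *)
Lemma clean_base p : clean p -> 3 < size p -> hubs T p = [::] -> clean (base p).
Proof.
move=> cl sp hp; have hzT := base_diagonal cl sp hp; have [pp cp _] := cl.
have [pm _ _ _ _] := polygon_mem pp; split.
- exact: base_polygon.
- move=> u v ub vb uv; rewrite between_base //; apply: cp => //; rewrite pm.
    by rewrite ub.
  by rewrite vb.
- by rewrite head_base //; apply: uncrossed_mem.
Qed.

(** Without hubs the only chord to [star p] is the root edge, whence the first summand. The root
    edge of [base p] is in [T], so it is counted on both sides. *)
Lemma degree_base p u : clean p -> 3 < size p -> hubs T p = [::] -> u \in base p ->
  degree p u = (u == head ord0 p) + degree (base p) u.
Proof.
move=> cl sp hp ub; have hzT := base_diagonal cl sp hp; have [pp cp _] := cl.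
have [pm hz zs im /andP[hb zb]] := polygon_mem pp.
rewrite degree_split // addnC; congr (_ + _).
  congr nat_of_bool; apply/andP/idP => [[/betweenP[w] wp uws]|/eqP->]; last first.
    split; last by rewrite eqxx orbT.
    apply/betweenP; exists (last ord0 (base p)); rewrite ?pm ?zb // zs andbT.
    have := triangulation_diagonal hT hzT; rewrite /is_diagonal /=; order_lia.
  case: (boolP (u == _)) => // uh; rewrite orbF => usT.
  suff : u \in hubs T p by rewrite hp.
  rewrite mem_filter usT im ub /=; move: uh; rewrite -val_eqE /=; have := hz u ub.
  by move: wp; rewrite pm => /orP[/hz|/eqP ws]; [order_lia | subst w; order_lia].
apply: eq_in_count => v vb; rewrite between_base // head_base //.
case: eqP => [->|_]; last by rewrite orbF.
by rewrite /star; case: eqP => [->|_]; rewrite ?hzT ?orbF.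
Qed.

(** * Subpolygons cut off by two edges ending at [star p] *)

Section Piece.
Variables (p : seq (vertex n)) (k k' : vertex n).
Hypothesis cl : clean p.
Hypotheses (kb : k \in base p) (kb' : k' \in base p) (kk' : k < k').
Hypothesis kT : (k == head ord0 p) || ((k, star p) \in T).
Hypothesis kT' : (k' == last ord0 (base p)) || ((k', star p) \in T).

Local Notation q := (rcons (segment (base p) k k') (star p)).

Lemma piece_polygon : is_polygon q.
Proof.
have [pp _ _] := cl.
have [||h _] := @pairmap_segment n p k [:: k'] pp kb; rewrite /= ?kk' //.
  by move=> v; rewrite inE => /eqP->.
by apply: h; rewrite mem_head.
Qed.

Lemma mem_piece v : (v \in q) = (v \in base p) && (k <= v <= k') || (v == star p).
Proof. by rewrite mem_rcons inE mem_filter orbC andbC. Qed.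

Lemma star_piece : star q = star p.
Proof. by rewrite /star last_rcons. Qed.

Lemma base_piece : base q = segment (base p) k k'.
Proof. by rewrite /base size_rcons -cats1 take_size_cat. Qed.

Lemma head_piece : head ord0 q = k.
Proof.
have [_ hz _ _ /andP[hb _]] := polygon_mem piece_polygon.
have kq : k \in base q by rewrite base_piece mem_filter kb leqnn ltnW.
have /andP[hk _] := hz k kq; move: hb; rewrite base_piece mem_filter.
case/andP=> /andP[kh _] _; apply/val_inj/eqP.
by rewrite eqn_leq hk kh.
Qed.

(** The edges from [k] and [k'] to [star p] are elements of [T], or the root edge and the last side
    of [p]. All other sides of the piece are sides of [p]. *)
Lemma piece_clean : clean q.
Proof.
have [pp cp rp] := cl; have [pm hz zs im /andP[hb zb]] := polygon_mem pp.
split; first exact: piece_polygon.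
  move=> u v uq vq uv nb.
  have up w : w \in q -> w \in p.
    by rewrite mem_piece pm => /orP[/andP[->]//|->]; rewrite orbT.
  have [/eqP vs|vs] := boolP (v == star p); last first.
    apply: cp; rewrite ?up //; apply: contra nb => /betweenP[w wp uwv].
    apply/betweenP; exists w; rewrite // mem_piece.
    move: wp; rewrite pm => /orP[wb|->]; last by rewrite orbT.
    move: vq uq; rewrite !mem_piece (negPf vs) orbF => /andP[vb vk].
    case/orP=> [/andP[ub uk]|/eqP us]; first by rewrite wb; order_lia.
    by subst u; have := hz v vb; order_lia.
  subst v; have ub : (u \in base p) && (k <= u <= k').
    by move: uq; rewrite mem_piece => /orP[//|/eqP us]; subst u; order_lia.
  (* Otherwise [k'] would lie between [u] and [star p]. *)
  have {ub} uk : u = k'.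
    case/andP: ub => ub ukk; apply/val_inj/eqP; rewrite eqn_leq [X in _ && X]leqNgt.
    apply/andP; split; first by case/andP: ukk.
    apply: contra nb => /= uk; apply/betweenP; exists k'; last by have := hz k' kb'; order_lia.
    by rewrite mem_piece kb' leqnn ltnW.
  subst u; case/orP: kT' => [/eqP kz|]; last exact: uncrossed_mem.
  apply: cp; rewrite ?up //; apply: contra nb => /betweenP[w].
  rewrite pm => /orP[/hz|/eqP ws]; last by subst w; order_lia.
  by rewrite -kz; order_lia.
rewrite head_piece star_piece; case/orP: kT => [/eqP->//|]; exact: uncrossed_mem.
Qed.

(** The last hypothesis says that no hub lies strictly between [k] and [k'], so among these [u] only
    [k] has a chord to [star p]. In the piece that chord counts as root edge, in [p] as root edge or
    element of [T]. *)
Lemma degree_piece u : u \in base p -> k <= u < k' ->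
  (forall x, x \in base p -> k < x < k' -> (x, star p) \notin T) ->
  degree q u = degree p u.
Proof.
move=> ub uk nT; have [pp cp rp] := cl.
have [pm hz zs im /andP[hb zb]] := polygon_mem pp.
rewrite !degree_split ?piece_polygon // head_piece star_piece base_piece count_filter.
have k's : k' < star p by have := hz k' kb'; order_lia.
congr (_ + _); last first.
  have -> : between q u (star p).
    apply/betweenP; exists k'; last by order_lia.
    by rewrite mem_piece kb' leqnn ltnW.
  have -> : between p u (star p).
    by apply/betweenP; exists k'; [rewrite pm kb' | order_lia].
  rewrite /=; congr nat_of_bool; have [->|uk'] := eqVneq u k.
    by rewrite orbT orbC kT.
  have ku : k < u < k' by move: uk'; rewrite -val_eqE /=; order_lia.
  rewrite (negPf (nT u ub ku)) /=; apply/esym/negbTE.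
  by rewrite -val_eqE /=; have := hz k kb; order_lia.
apply: eq_in_count => v vb /=; case: (boolP ((u, v) \in T)) => uvT; rewrite ?andbF ?andbT //.
apply/andP/idP => [[/betweenP[w wq uwv] vk]|/betweenP[w wp uwv]].
  apply/betweenP; exists w => //; move: wq; rewrite mem_piece pm.
  by case/orP=> [/andP[->]//|->]; rewrite orbT.
(* A chord from [u] to a vertex beyond [k'] but before [star p] would cross [(k', star p)]. *)
have vk : v <= k'.
  case/orP: kT' => [/eqP->|k'T]; first by have := hz v vb; order_lia.
  have := uncrossedP _ _ (uncrossed_mem k'T) u v uvT; rewrite /crosses /=.
  by have := hz v vb; order_lia.
split; last by order_lia.
apply/betweenP; exists w => //; rewrite mem_piece; move: wp; rewrite pm.
by case/orP=> [->|->]; rewrite ?orbT //; order_lia.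
Qed.

(** In the piece, [k'] is followed by [star p] alone; its chords in [p] are left to the next piece,
    so nothing is counted twice. *)
Lemma degree_piece_last : degree q k' = 0.
Proof.
have [pp cp rp] := cl; have [pm hz zs im /andP[hb zb]] := polygon_mem pp.
rewrite degree_split ?piece_polygon // star_piece base_piece.
have -> : between q k' (star p) = false.
  apply/betweenP => -[w]; rewrite mem_piece => /orP[|/eqP->]; order_lia.
rewrite addn0; apply/eqP; rewrite -leqn0 leqNgt -has_count; apply/hasPn => v.
rewrite mem_filter => /andP[/andP[_ vk] _]; rewrite negb_and; apply/orP; left.
by apply/betweenP => -[w _]; order_lia.
Qed.

Lemma count_piece u : u \in base p -> k <= u <= k' ->
  count (fun w : vertex n => w < u) q = count (fun w : vertex n => k <= w < u) (base p).
Proof.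
move=> ub uk; have [pp _ _] := cl; have [_ hz zs _ _] := polygon_mem pp.
rewrite -cats1 count_cat /= count_filter.
have -> : (star p < u) = false by have := hz u ub; order_lia.
by rewrite !addn0; apply: eq_count => w /=; order_lia.
Qed.

(** The left side is the number of horizontal steps in the word of the piece, hence the shift of
    abscissas in the words that follow. *)
Lemma size_piece : size q - 2 = count (fun w : vertex n => k <= w < k') (base p).
Proof.
have [pp _ _] := cl; have /andP[_ sp] := pp.
have ub : uniq (base p).
  apply: (@sorted_uniq _ (fun u v : vertex n => u < v)).
  - by move=> ? ? ?; apply: ltn_trans.
  - by move=> ?; apply: ltnn.
  exact: take_sorted.
rewrite size_rcons size_filter.
rewrite (eq_count (a2 := fun v : vertex n => (k <= v < k'.+1)%N)); last by [].
rewrite (count_split _ (b := k')); last by order_lia.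
rewrite [X in _ + X](_ : _ = 1); first by order_lia.
rewrite (eq_count (a2 := pred1 k')) ?count_uniq_mem ?kb' // => v /=.
by rewrite ltnS -eqn_leq eq_sym.
Qed.

End Piece.

(** * Vertical steps of the words of subpolygons *)

(** Induction on the list of breaks, so the statement covers any tail of it, with ranks counted from
    [k]. The alternative that [k] is the last vertex of [base p] is for the empty tail. *)
Lemma flatten_ups p (f : seq (vertex n) -> seq bool) k ks :
  clean p -> k \in base p -> {subset ks <= base p} ->
  path (fun u v : vertex n => u < v) k ks -> last k ks = last ord0 (base p) ->
  [|| k == last ord0 (base p), k == head ord0 p | (k, star p) \in T] ->
  {in ks, forall x, (x == last ord0 (base p)) || ((x, star p) \in T)} ->
  {in base p, forall x : vertex n, k < x -> (x, star p) \in T -> x \in ks} ->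
  let qs := pairmap (fun k k' => rcons (segment (base p) k k') (star p)) k ks in
  {in qs, forall q, clean q -> is_dyck (size q - 2) (f q) /\
     {in q, forall u, ups (f q) (count (fun w : vertex n => w < u) q) = degree q u}} ->
  {in base p, forall u, k <= u ->
     ups (flatten [seq f q | q <- qs]) (count (fun w : vertex n => k <= w < u) (base p))
     = degree p u}.
Proof.
move=> cl; have [pp _ _] := cl; have [pm hz zs im _] := polygon_mem pp.
have tr : transitive (fun u v : vertex n => (u < v)%N).
  by move=> ? ? ?; apply: ltn_trans.
elim: ks k => [|k' ks IH] k kb sub /=.
  move=> _ kz _ _ _ _ u ub ku; rewrite ups_nil degree_split //.
  have uz : u = last ord0 (base p).
    by apply/val_inj/eqP; rewrite eqn_leq /=; have := hz u ub; rewrite -kz; order_lia.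
  have nb v : v \in p -> ~~ between p u v.
    rewrite pm uz => vp; apply/betweenP => -[w]; rewrite pm.
    by case/orP=> [/hz|/eqP->]; case/orP: vp => [/hz|/eqP->]; order_lia.
  rewrite (negPf (nb _ _)) ?pm ?eqxx ?orbT // addn0; apply/esym/eqP.
  rewrite -leqn0 leqNgt -has_count; apply/hasPn => v vb.
  by rewrite (negPf (nb _ _)) // pm vb.
case/andP=> kk' pk kz kT ksT hT' fq u ub ku.
have kb' : k' \in base p by apply: sub; rewrite mem_head.
have {}kT : (k == head ord0 p) || ((k, star p) \in T).
  by move: kT; rewrite -val_eqE /=; have := hz k' kb'; order_lia.
have kT' := ksT k' (mem_head _ _).
have /allP km := order_path_min tr pk.
have clq := piece_clean cl kb kb' kk' kT kT'.
have [/dyckP[_ cf _] uq] := fq _ (mem_head _ _) clq.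
rewrite (size_piece cl kb' kk') in cf.
have k's : k' < star p by have := hz k' kb'; order_lia.
rewrite ups_cat cf.
have [uk'|k'u] := ltnP u k'.
  have uinq : u \in rcons (segment (base p) k k') (star p).
    by rewrite mem_piece ub; order_lia.
  (* The rank of [u] is below the number of horizontal steps of the first word, so later words do
     not reach this abscissa. *)
  rewrite ifF; last first.
    apply/negbTE; rewrite -ltnNge [X in _ < X](count_split _ (b := u)); last by order_lia.
    rewrite -[X in X < _]addn0 ltn_add2l -has_count; apply/hasP; exists u => //=; order_lia.
  rewrite addn0 -(count_piece cl (k' := k')) ?uq //; last by order_lia.
  apply: degree_piece => // [|x xb kxk']; first by order_lia.
  apply/negP => /(hT' x xb); rewrite inE => /(_ _)/predU1P.
  by case=> [|xk'|/km]; [order_lia | subst x; order_lia | order_lia].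
rewrite (count_split _ (b := k')); last by order_lia.
rewrite leq_addr addKn.
(* The first word contributes nothing: at [u = k'] because [k'] has degree 0 in the first piece,
   beyond it because the abscissa is too large. *)
rewrite [X in X + _](_ : _ = 0) ?add0n; last first.
  have [c0|c0] := posnP (count (fun w : vertex n => k' <= w < u) (base p)).
    rewrite c0 addn0 -(count_piece cl (k' := k')) ?uq //; last by order_lia.
      exact: degree_piece_last.
    by rewrite mem_piece kb' leqnn ltnW.
  by apply: ups_large; rewrite cf; order_lia.
apply: IH => //.
- by move=> x xk; apply: sub; rewrite inE xk orbT.
- by case/orP: kT' => ->; rewrite ?orbT.
- by move=> x xk; apply: ksT; rewrite inE xk orbT.
- move=> x xb k'x xT; have := hT' x xb (ltn_trans kk' k'x) xT.
  by rewrite inE => /predU1P[xk|//]; subst x; order_lia.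
- by move=> x xk; apply: fq; rewrite inE xk orbT.
Qed.

(** The vertex [star p] is included because, in the step to [base p], the last vertex there is an
    ordinary vertex of [p]. *)
Lemma ups_path_word fuel p : clean p -> size p <= fuel ->
  {in p, forall u, ups (path_word T fuel p) (count (fun w : vertex n => w < u) p)
                   = degree p u}.
Proof.
elim: fuel p => [|fuel IH] p cl; have [pp cp _] := cl; have /andP[p3 _] := pp.
  by move=> pf; move: (leq_trans p3 pf).
have [pE bE] := polygonE pp.
have [pm hz zs im /andP[hb zb]] := polygon_mem pp.
have cntE u : count (fun w : vertex n => w < u) p =
              count (fun w : vertex n => w < u) (base p) + (star p < u).
  by rewrite {1}pE -cats1 count_cat /= addn0.
(* The rank of [star p] is [size p - 1], one more than the largest abscissa in the word. *)
move=> pf u; rewrite pm => /orP[ub|/eqP->]; last first.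
  rewrite degree_star // cntE ltnn addn0.
  have -> : count (fun w : vertex n => w < star p) (base p) = size (base p).
    by apply/eqP; rewrite -all_count; apply/allP => w /hz; order_lia.
  have /dyckP[_ cf _] := path_word_dyck T pp pf.
  by apply: ups_large; rewrite cf size_base; order_lia.
rewrite cntE (_ : (star p < u) = false) ?addn0; last by have := hz u ub; order_lia.
(* Only the distinguished vertex has rank 0, so an initial vertical step matches the root edge. *)
have cnt0 : (count (fun w : vertex n => w < u) (base p) == 0) = (u == head ord0 p).
  rewrite -leqn0 leqNgt -has_count; apply/hasPn/eqP => [h|-> w /hz]; last by order_lia.
  have := h _ hb; have := hz u ub => hu nu.
  by apply/val_inj/eqP; rewrite eqn_leq [X in X && _]leqNgt nu; case/andP: hu.
rewrite [path_word _ _ _]/=; case: leqP => [p3'|p4].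
  have i0 : inner p = [::] by rewrite /inner (eqP (_ : size p - 3 == 0)) ?take0 ?subn_eq0.
  have bhz w : w \in base p -> (w = head ord0 p) \/ (w = last ord0 (base p)).
    by rewrite bE i0 !inE => /orP[]/eqP->; [left|right].
  rewrite -[[:: true; false]]/(true :: rcons [::] false) ups_up ups_nil cnt0 addn0.
  rewrite degree_split // [count _ _](_ : _ = 0) ?add0n; last first.
    apply/eqP; rewrite -leqn0 leqNgt -has_count; apply/hasPn => v vb.
    rewrite negb_and; apply/orP; left; apply/betweenP => -[w]; rewrite pm => wp.
    have := hz u ub; have := hz v vb.
    by case/orP: wp => [/bhz[]->|/eqP->]; order_lia.
  congr nat_of_bool; case: (bhz u ub) => ->.
    rewrite eqxx orbT andbT; apply/esym/betweenP; exists (last ord0 (base p)).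
      by rewrite pm zb.
    rewrite zs andbT; case/andP: pp => _; rewrite pE bE i0 /=.
    by case/andP.
  rewrite [between _ _ _](_ : _ = false) /=; last first.
    by apply/betweenP => -[w]; rewrite pm => /orP[/hz|/eqP->]; order_lia.
  apply/negbTE; rewrite -val_eqE /= gtn_eqF //.
  by case/andP: pp => _; rewrite pE bE i0 /= => /andP[].
case E: (hubs T p) => [|x xs].
  have szb : size (base p) <= fuel by rewrite size_base; order_lia.
  by rewrite ups_up cnt0 (IH _ (clean_base cl p4 E) szb u ub) (degree_base cl p4 E ub).
have [h1 h2 h3] := breaks_polygon T pp.
(* All of [base p] lies weakly above its head, so the rank can be counted from there. *)
rewrite (eq_in_count (a2 := fun w : vertex n => head ord0 p <= w < u)); last first.
  by move=> w /hz /andP[-> _].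
apply: (flatten_ups (p := p) (f := path_word T fuel) (k := head ord0 p)
    (ks := rcons (hubs T p) (last ord0 (base p)))) => //.
- by rewrite last_rcons.
- by rewrite eqxx orbT.
- move=> v; rewrite mem_rcons inE => /orP[->//|].
  by rewrite mem_filter => /andP[->]; rewrite orbT.
- move=> v vb hv vT; rewrite mem_rcons inE mem_filter vT im vb hv /=.
  by have := hz v vb; rewrite -val_eqE /=; order_lia.
- move=> q qp cq; have [pq _ _] := cq.
  have sq : size q <= fuel.
    have : size q < size p by apply: pieces_small qp => //; rewrite E.
    by order_lia.
  by split; [apply: path_word_dyck | apply: IH].
by case/andP: (hz u ub).
Qed.

(** Crossing a pair requires an endpoint strictly inside it, and every vertex is in the list. The
    root edge joins the extreme vertices, so nothing reaches outside it. *)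
Lemma clean_whole : clean (whole_polygon n).
Proof.
have pp := whole_polygonP n; split=> //.
  move=> u v _ _ uv nb; apply/uncrossedP => x y _; apply/negP => xy.
  suff [w uwv] : exists w : vertex n, u < w < v.
    by case/betweenP: nb; exists w; rewrite ?mem_enum.
  by move: xy; rewrite /crosses /= => /orP[]/and3P[*]; [exists y|exists x]; apply/andP.
have [pm hz zs _ /andP[hb _]] := polygon_mem pp.
have all_mem v : head ord0 (whole_polygon n) <= v <= star (whole_polygon n).
  have : v \in whole_polygon n by rewrite mem_enum.
  by rewrite pm => /orP[/hz|/eqP->]; [order_lia | have := hz _ hb; order_lia].
apply/uncrossedP => x y _; rewrite /crosses /=.
by have := all_mem x; have := all_mem y; order_lia.
Qed.

End Polygons.

(** * Comparison of the two exponents for the whole polygon *)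

Lemma M_D n (T : {set vertex n * vertex n}) : triangulation T ->
  M (D T) = (\sum_(d | (d \in T) && ~~ is_negative d) U_(var n d.1))%MM.
Proof.
move=> hT; apply/mnmP => i; rewrite M_ups mnm_sumE.
(* A positive diagonal has its smaller endpoint between 1 and [n], so [inord] does not wrap around
   and the last variable never occurs. *)
have di (d : vertex n * vertex n) : d \in T -> ~~ is_negative d ->
  (var n d.1 == i) = (d.1 == i.+1 :> nat) && (i < n)%N.
  case: d => [a b] /(triangulation_diagonal hT)/andP[/= ab _].
  rewrite /is_negative -!val_eqE /= => a0.
  have an : (a <= n)%N by have := ltn_ord b; lia.
  rewrite inordK; lia.
rewrite (eq_bigr
    (fun d : vertex n * vertex n => (d.1 == i.+1 :> nat) && (i < n)%N : nat));
  last by move=> d /andP[dT d0]; rewrite mnm1E di.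
case: ifP => [i_n|_]; last by rewrite big1 // => d _; rewrite andbF.
pose u : vertex n := inord i.+1.
have uE : u = i.+1 :> nat by rewrite inordK; lia.
(* In the whole polygon the rank of a vertex is its number. *)
have cu : count (fun w : vertex n => w < u)%N (whole_polygon n) = i.+1.
  rewrite -uE -(count_map val (fun w => w < u)%N) val_enum_ord.
  have -> : iota 0 n.+3 = iota 0 u ++ iota u (n.+3 - u).
    by rewrite -iotaD subnKC // ltnW.
  rewrite count_cat (eqP (_ : count _ (iota 0 u) == u)).
    rewrite (eqP (_ : count _ (iota u _) == 0)%N) ?addn0 //.
    by rewrite -leqn0 leqNgt -has_count; apply/hasPn => w; rewrite mem_iota; lia.
  rewrite -[X in _ == X](size_iota 0) -all_count; apply/allP => w.
  by rewrite mem_iota.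
have := ups_path_word hT (fuel := n.+3) (clean_whole hT).
rewrite size_enum_ord leqnn => /(_ isT u); rewrite mem_enum cu => /(_ isT) ->.
(* As [u] is not the distinguished vertex, the root edge does not enter its degree. *)
have hd : (u == head ord0 (whole_polygon n)) = false.
  by rewrite /whole_polygon enum_ordSl -val_eqE /= uE.
rewrite /degree (eq_count (a2 := fun v => (u, v) \in T)); last first.
  move=> v; rewrite hd orbF; case: (boolP (_ \in T)) => uv; rewrite ?andbF ?andbT //.
  (* A diagonal from [u] ends beyond [u.+1], so the condition on an intermediate vertex is
     automatic. *)
  apply/betweenP; exists (inord u.+1); first by rewrite mem_enum.
  have /andP[/= h _] := triangulation_diagonal hT uv.
  by rewrite inordK; have := ltn_ord v; lia.
rewrite -sum1_count big_mkcond [RHS]big_mkcond big_enum /=.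
transitivity (\sum_(a : vertex n) \sum_(b : vertex n)
    if ((a, b) \in T) && ~~ is_negative (a, b)
    then (a == i.+1 :> nat) : nat else 0)%N; last first.
  by rewrite pair_bigA; apply: eq_bigr => -[a b] _ /=; rewrite andbT.
rewrite [RHS](bigD1 u) //= [X in (_ + X)%N]big1 ?addn0 => [|a au]; last first.
  rewrite big1 // => b _; rewrite -uE val_eqE (negPf au).
  by case: ifP.
apply: eq_bigr => v _; rewrite uE eqxx /is_negative -val_eqE /= uE andbT.
by case: ifP.
Qed.

Theorem proposition2p1 (R : comNzRingType) (n : nat)
    (T : {set vertex n * vertex n}) (hT : triangulation T) :
  is_leading_monomial (B R T) (M (D T)).
Proof. by rewrite M_D //; apply: B_leading. Qed.
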